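(* Let $\omega$ be a permutation and $\alpha=\alpha_1\alpha_2\cdots\alpha_l$ a reduced word of $\omega$. Let $T_\alpha$ be the standard tower tableau of $\alpha$ and $D_\alpha$ the canonical labelling of the Rothe diagram $D_\omega$ associated to $\alpha$. Then the Rothification of $T_\alpha$ equals $D_\alpha$, i.e. $R_{T_\alpha}=D_\alpha$ (same cells and same labels).
   Context: Permutations are written in one-line notation $\omega=\omega_1\cdots\omega_n$; $s_a=(a,a+1)$ and $\omega s_a$ swaps the entries in positions $a,a+1$; a reduced word of $\omega$ is a word $\alpha_1\cdots\alpha_l$ with $\omega=s_{\alpha_1}\cdots s_{\alpha_l}$, $l$ the number of inversions of $\omega$. A tower diagram is a finite sequence $(\mathcal T_1,\mathcal T_2,\ldots)$ of towers; the $i$-th tower of size $k_i\ge0$ consists of the cells $(i,0),\ldots,(i,k_i-1)$, the cell $(i,j)$ being the unit square $[i-1,i]\times[j,j+1]$ identified with its south-east corner, lying on the diagonal $x+y=i+j$; $i$ is its tower index. Sliding. For a positive integer $a$ and a tail $(\mathcal T_p,\ldots)$ of a tower diagram, $a^{\searrow}(\mathcal T_p,\ldots)$ either adds one cell or terminates: (S1) if no tower $\mathcal T_t$, $t\ge p$, has a cell on $x+y=a-1$: (a) if none has a cell on $x+y=a$, add $(a,0)$; (b) if $(a,0)\in\mathcal T_a$, $(a,1)\notin\mathcal T_a$, terminate; (c) if $(a,0),(a,1)\in\mathcal T_a$, result is $(a+1)^{\searrow}(\mathcal T_{a+1},\ldots)$. (S2) Otherwise, with $\mathcal T_i$ ($i\ge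 p$) the leftmost tower having a cell $(i,a-1-i)$: (a) if $(i,a-i)\notin\mathcal T_i$, add it; (b) if $(i,a-i)\in\mathcal T_i$, $(i,a-i+1)\notin\mathcal T_i$, terminate; (c) if both are in $\mathcal T_i$, result is $(a+1)^{\searrow}(\mathcal T_{i+1},\ldots)$. Sliding $a$ into $\mathcal T$ is $a^{\searrow}(\mathcal T_1,\ldots)$. The standard tower tableau $T_\alpha$ of a reduced word $\alpha$ is obtained by sliding its letters one by one into the empty diagram and labelling the cell created by the $k$-th letter with $k$. Rothe diagram: $D_\omega=\{(i,\omega_j): i<j,\ \omega_i>\omega_j\}$, $(r,c)$ meaning row $r$ (rows numbered top to bottom), column $c$. Rothification: for a standard tower tableau $T$ with reading word $\alpha_1\cdots\alpha_l$, let $T'$ be the standard tower tableau of the reversed word $\alpha_l\cdots\alpha_1$; for $1\le r\le l$ let $u_r$ be the cell of $T$ labelled $r$ and $v_r$ the cell of $T'$ labelled $l+1-r$. $R_T$ puts label $r$ on the cell in row (tower index of $v_r$) and column (tower index of $u_r$). Canonical labelling: for a reduced word $\alpha=\alpha_1\cdots\alpha_l$ of $\omega$, form $w^{(0)}=\mathrm{id}$, $w^{(r)}=w^{(r-1)}s_{\alpha_r}$ (so $w^{(l)}=\omega$); step $r$ swaps two values $b>c$. $D_\alpha$ labels the cell $(i,j)\in D_\omega$ (where $j<\omega_i$) by the unique $r$ such that step $r$ swaps the values $\omega_i$ and $j$. *)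

(* Defs.v *)
From mathcomp Require Import all_boot all_fingroup finmap.

Set Implicit Arguments.
Unset Strict Implicit.
Unset Printing Implicit Defensive.

(* Letters, rows, columns, tower indices and labels are 1-based naturals;
   a permutation of {1..n} is an element of 'S_n, so that the i-th entry of
   its one-line notation is (w (i-1)).+1. *)

(** * Permutations and reduced words *)

(* s_a = (a, a+1) for 0 < a < n, and the identity otherwise. *)
Definition adjtransp (n a : nat) : 'S_n :=
  match insub a.-1, insub a with
  | Some i, Some j => tperm i j
  | _, _ => 1%g
  end.

(* s_(alpha_1) ... s_(alpha_l).  As (u * v)%g i = v (u i) in MathComp, the
   product w s_a swapping the entries of w in positions a and a+1 is
   (s_a * w)%g. *)
Definition word_perm (n : nat) (alpha : seq nat) : 'S_n :=
  foldl (fun w a => (adjtransp n a * w)%g) 1%g alpha.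

Definition inversions (n : nat) (w : 'S_n) : {set 'I_n * 'I_n} :=
  [set p : 'I_n * 'I_n | (p.1 < p.2) && (w p.2 < w p.1)].

Definition reduced_word (n : nat) (w : 'S_n) (alpha : seq nat) : bool :=
  [&& all (fun a => 0 < a < n) alpha,
      word_perm n alpha == w
    & size alpha == #|inversions w|].

(** * Tower diagrams and sliding *)

(* The sequence k_1, k_2, ... of tower sizes; missing towers have size 0. *)
Definition tower_diagram := seq nat.

Definition cell := (nat * nat)%type.

Definition tower_cell (T : tower_diagram) (c : cell) : bool :=
  (0 < c.1) && (c.2 < nth 0 T c.1.-1).

(* The i-th tower has a cell on the diagonal x + y = d. *)
Definition meets_diag (T : tower_diagram) (d i : nat) : bool :=
  (i <= d) && tower_cell T (i, d - i).

(* The towers of index at least p having a cell on x + y = d, from left to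
   right. *)
Definition diag_towers (T : tower_diagram) (p d : nat) : seq nat :=
  [seq i <- index_iota p (size T).+1 | meets_diag T d i].

(* Sliding a into the tail (T_p, T_(p+1), ...): the new cell, or None if the
   sliding terminates without adding one.  The recursion is bounded by n; see
   slide_fromE for the recursion without the bound. *)
Fixpoint slide_rec (n : nat) (T : tower_diagram) (p a : nat) : option cell :=
  if n is m.+1 then
    match diag_towers T p a.-1 with
    | [::] =>
        if nilp (diag_towers T p a) then Some (a, 0)
        else if ~~ tower_cell T (a, 1) then None
        else slide_rec m T a.+1 a.+1
    | i :: _ =>
        if ~~ tower_cell T (i, a - i) then Some (i, a - i)
        else if ~~ tower_cell T (i, (a - i).+1) then None
        else slide_rec m T i.+1 a.+1
    end
  else None.

Definition slide_from (T : tower_diagram) (p a : nat) : option cell :=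
  slide_rec ((size T).+1 - p).+1 T p a.

Definition slide (T : tower_diagram) (a : nat) : option cell :=
  slide_from T 1 a.

Definition add_cell (T : tower_diagram) (c : cell) : tower_diagram :=
  incr_nth T c.1.-1.

Lemma mem_diag_towers T p d i :
  (i \in diag_towers T p d) = [&& p <= i, i <= size T & meets_diag T d i].
Proof. by rewrite mem_filter mem_index_iota ltnS andbC -andbA. Qed.

Lemma tower_cell_size T c : tower_cell T c -> 0 < c.1 <= size T.
Proof.
case: c => [[|i] j] //=; rewrite /tower_cell /= => h.
by rewrite ltnNge; apply/negP => h'; rewrite nth_default in h.
Qed.

Lemma slide_rec_fuel T n m p a : p <= a ->
  (size T).+1 - p < n -> (size T).+1 - p < m ->
  slide_rec n T p a = slide_rec m T p a.
Proof.
elim: n m p a => [|n IH] [|m] p a //= le_pa ltn ltm.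
case E: (diag_towers T p a.-1) => [|i s].
  case: ifP => // _; case: ifP => // /negbFE /tower_cell_size /andP[/= _ le_a].
  have lt : (size T).+1 - a.+1 < (size T).+1 - p.
    by apply: ltn_sub2l; [apply: leq_ltn_trans le_pa _ | rewrite ltnS].
  by apply: IH => //; apply: leq_trans lt _; rewrite -ltnS.
have : i \in diag_towers T p a.-1 by rewrite E mem_head.
rewrite mem_diag_towers => /and3P[le_pi le_iT /andP[le_ia _]].
case: ifP => // _; case: ifP => // _.
have lt : (size T).+1 - i.+1 < (size T).+1 - p.
  by apply: ltn_sub2l; [apply: leq_ltn_trans le_pi _ | rewrite ltnS].
apply: IH; [|by apply: leq_trans lt _; rewrite -ltnS..].
by rewrite ltnS; apply: leq_trans le_ia (leq_pred _).
Qed.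

(* The sliding rules.  Starting from p = 1, p <= a holds throughout.  In the
   first case, if the second list is not empty then it can only contain a, with
   (a, 0) in the a-th tower. *)
Lemma slide_fromE T p a : p <= a ->
  slide_from T p a =
  match diag_towers T p a.-1 with
  | [::] =>
      if nilp (diag_towers T p a) then Some (a, 0)
      else if ~~ tower_cell T (a, 1) then None
      else slide_from T a.+1 a.+1
  | i :: _ =>
      if ~~ tower_cell T (i, a - i) then Some (i, a - i)
      else if ~~ tower_cell T (i, (a - i).+1) then None
      else slide_from T i.+1 a.+1
  end.
Proof.
move=> le_pa; have [n lt_n] : {n | (size T).+1 - p < n} by exists ((size T).+1 - p).+1.
rewrite {1}/slide_from (@slide_rec_fuel _ _ n.+1 _ _ le_pa) //=; last exact: leqW.
case E: (diag_towers T p a.-1) => [|i s].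
  case: ifP => // _; case: ifP => // _; apply: slide_rec_fuel => //.
  by apply: leq_ltn_trans lt_n; rewrite leq_sub2l ?leqW.
have : i \in diag_towers T p a.-1 by rewrite E mem_head.
rewrite mem_diag_towers => /and3P[le_pi _ /andP[le_ia _]].
case: ifP => // _; case: ifP => // _; apply: slide_rec_fuel => //.
  by rewrite ltnS; apply: leq_trans le_ia (leq_pred _).
by apply: leq_ltn_trans lt_n; rewrite leq_sub2l ?leqW.
Qed.

(** * Standard tower tableaux *)

(* A standard tower tableau is given by the list of its cells in the order of
   their labels 1, 2, ..., l. *)
Definition tower_tableau := seq cell.

Definition cell_labelled (U : tower_tableau) (r : nat) : cell :=
  nth (0, 0) U r.-1.

Definition shape (U : tower_tableau) : tower_diagram := foldl add_cell [::] U.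

Fixpoint slide_word (T : tower_diagram) (alpha : seq nat) :
    option tower_tableau :=
  if alpha is a :: beta then
    obind (fun c => omap (cons c) (slide_word (add_cell T c) beta)) (slide T a)
  else Some [::].

(* T_alpha, or None if one of the slidings terminates. *)
Definition standard_tableau (alpha : seq nat) : option tower_tableau :=
  slide_word [::] alpha.

(* The letter whose sliding into T creates the cell c.  It cannot exceed
   c.1 + c.2, since sliding only moves to larger diagonals. *)
Definition sliding_letter (T : tower_diagram) (c : cell) : nat :=
  (find (fun a => slide T a == Some c) (iota 1 (c.1 + c.2))).+1.

(* The word alpha with standard_tableau alpha = Some U. *)
Definition reading_word (U : tower_tableau) : seq nat :=
  [seq sliding_letter (shape (take r.-1 U)) (cell_labelled U r)
     | r <- iota 1 (size U)].

(** * Labelled diagrams: Rothification and canonical labelling *)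

(* A labelled diagram is its finite set of pairs ((row, column), label). *)
Definition labelled_diagram := {fset cell * nat}.

Definition rothification (U : tower_tableau) : option labelled_diagram :=
  omap (fun U' : tower_tableau =>
          [fset (((cell_labelled U' ((size U).+1 - r)).1,
                  (cell_labelled U r).1), r)
             | r in iota 1 (size U)]%fset)
       (standard_tableau (rev (reading_word U))).

(* D_w, as the set of pairs (row index, value) in 'I_n. *)
Definition rothe_diagram (n : nat) (w : 'S_n) : {set 'I_n * 'I_n} :=
  [set (p.1, w p.2) | p in inversions w].

(* Step r of the word swaps the values b and c.  Composing on the right with
   tperm b c acts on values in MathComp's convention. *)
Definition swaps_at (n : nat) (alpha : seq nat) (b c : 'I_n) (r : nat) : bool :=
  word_perm n (take r alpha) == (word_perm n (take r.-1 alpha) * tperm b c)%g.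

(* In a reduced word each pair of values is swapped at most once.  If it is
   never swapped the value is the non-label (size alpha).+1. *)
Definition swap_step (n : nat) (alpha : seq nat) (b c : 'I_n) : nat :=
  (find (swaps_at alpha b c) (iota 1 (size alpha))).+1.

Definition canonical_labelling (n : nat) (w : 'S_n) (alpha : seq nat) :
    labelled_diagram :=
  [fset ((d.1.+1, d.2.+1), swap_step alpha (w d.1) d.2)
     | d : 'I_n * 'I_n in rothe_diagram w]%fset.

(* Main.v *)
(** The tower diagram obtained by sliding a reduced word of u has as its p-th
    tower the p-th column of the Rothe diagram of u.  Passing the p-th tower
    amounts to deleting the value p from the one-line notation of u: the letter
    sliding into the tail from p points at two adjacent entries of u restricted
    to the values >= p, and it moves to the next diagonal, stays on its diagonal,
    or creates a cell according to whether p lies to the right of these entries,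
    to their left, or is the first of them.  Hence a step swapping the values
    c < b creates a cell in tower c, which gives the columns of the
    Rothification.

    Reversing the word gives the rows: if w = u s_a v^-1, where v is the
    permutation of the reversed remaining word, then the smaller of the two
    values v swaps at positions a, a+1 is v(a), and w(v(a)) = u(a+1) = b, so v(a)
    is the row of the cell.  Each label thus sits on the right cell, and both
    diagrams have as many cells as w has inversions. *)

Require Import Defs.
From mathcomp Require Import all_boot all_fingroup finmap.
From mathcomp Require Import zify.

Set Implicit Arguments.
Unset Strict Implicit.
Unset Printing Implicit Defensive.

(** * Sliding as a recursion over single towers *)

Lemma diag_towers_cons T d p : meets_diag T d p ->
  diag_towers T p d = p :: diag_towers T p.+1 d.
Proof.
move=> h; have /andP[_ /tower_cell_size /andP[_ /= le_p]] := h.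
by rewrite /diag_towers {1}/index_iota subSn //= h /index_iota subSS.
Qed.

Lemma diag_towers_skip T d p : ~~ meets_diag T d p ->
  diag_towers T p d = diag_towers T p.+1 d.
Proof.
move=> h; rewrite /diag_towers /index_iota subSS.
have [le_p|lt_p] := leqP p (size T); first by rewrite subSn //= (negPf h).
have [-> ->] // : (size T).+1 - p = 0 /\ size T - p = 0 by lia.
Qed.

Lemma diag_towers_gt T d p : d < p -> diag_towers T p d = [::].
Proof.
move=> lt_dp; apply/eqP; rewrite -[_ == _]negbK -has_filter.
apply/hasP => -[i]; rewrite mem_index_iota /meets_diag => /andP[le_pi _] /andP[].
by rewrite leqNgt (leq_trans lt_dp).
Qed.

(** A tower of size less than [a - p] misses both diagonals of the rule and is skipped. Otherwise
    either it is the leftmost one on the diagonal of [a.-1], or [p = a], where the ground-level rule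
    yields the same comparisons. *)
Lemma slide_from_step T p a : 0 < p <= a ->
  slide_from T p a =
  if nth 0 T p.-1 == a - p then Some (p, a - p)
  else if nth 0 T p.-1 == (a - p).+1 then None
  else if a - p < nth 0 T p.-1 then slide_from T p.+1 a.+1
  else slide_from T p.+1 a.
Proof.
move=> /andP[p_gt0 le_pa].
have cellE j : tower_cell T (p, j) = (j < nth 0 T p.-1).
  by rewrite /tower_cell /= p_gt0.
have meetsE d : meets_diag T d p = (p <= d) && (d - p < nth 0 T p.-1).
  by rewrite /meets_diag cellE.
move: (nth 0 T p.-1) cellE meetsE => k cellE meetsE.
have [h|h] := boolP (meets_diag T a.-1 p).
  rewrite slide_fromE // (diag_towers_cons h) !cellE.
  move: h; rewrite meetsE => /andP[h1 h2]; clear -h1 h2 p_gt0.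
  have [-> ->] : ((a - p < k) = (k != a - p)) * (((a - p).+1 < k) = (k != a - p) && (k != (a - p).+1)) by split; lia.
  by case: eqP => //= _; case: eqP.
move: (h); rewrite meetsE => h'.
move: le_pa; rewrite leq_eqVlt => /predU1P[eq_pa|lt_pa].
  rewrite slide_fromE ?eq_pa // diag_towers_gt; last by rewrite -eq_pa prednK.
  rewrite -eq_pa subnn.
  have -> : nilp (diag_towers T p p) = (k == 0).
    have := meetsE p; rewrite leqnn subnn /=.
    have [/diag_towers_cons -> /=|h2] := boolP (meets_diag T p p); first by case: k {cellE meetsE h'}.
    by rewrite diag_towers_skip // diag_towers_gt //; case: k {cellE meetsE h'}.
  by rewrite cellE; clear; case: k => [|[|k]].
have h2 : ~~ meets_diag T a p by rewrite meetsE; clear -h' lt_pa; lia.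
have -> : slide_from T p a = slide_from T p.+1 a.
  rewrite slide_fromE ?(ltnW lt_pa) // [RHS]slide_fromE //.
  by rewrite !(diag_towers_skip h) (diag_towers_skip h2).
have lt_k : k < a - p by clear -h' lt_pa; lia.
have lt_k1 : k < (a - p).+1 := leqW lt_k.
by rewrite (ltn_eqF lt_k) (ltn_eqF lt_k1) ltnNge (ltnW lt_k).
Qed.

Lemma nth_gt0_size (s : seq nat) i : 0 < nth 0 s i -> i < size s.
Proof. by have [/(nth_default 0)->|] := leqP (size s) i. Qed.

(** The first bound separates a cell added in tower [p] from later ones; the second keeps the letter
    within the search range of [sliding_letter]. *)
Lemma slide_from_bounds T p a c : 0 < p <= a -> slide_from T p a = Some c ->
  p <= c.1 /\ a <= c.1 + c.2.
Proof.
(* Skipping a small tower lowers [a - p]; passing a tall one, which must lie within [T], keeps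
   [a - p] and lowers the other term. *)
have [m] := ubnP (((size T).+1 - p) + (a - p)).
elim: m p a => // m IH p a lt_m hpa; rewrite slide_from_step //.
have := @nth_gt0_size T p.-1; move: (nth 0 T p.-1) => k gt0_size.
case: eqP => [_ [<-] /=|nk]; first by split; lia.
case: eqP => // nk1; case: ltnP => [hk|hk] hs.
  have lt_pT : p.-1 < size T by apply: gt0_size; lia.
  by have [||[h1 h2]] := IH _ _ _ _ hs; lia.
by have [||[h1 h2]] := IH _ _ _ _ hs; lia.
Qed.

(* Passing a tower of size k maps the remaining values d = a - p, namely d < k-1
   and d > k, to d and d - 1 respectively, hence injectively. *)
Lemma slide_from_inj T p a b c : 0 < p <= a -> p <= b ->
  slide_from T p a = Some c -> slide_from T p b = Some c -> a = b.
Proof.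
have [m] := ubnP (((size T).+1 - p) + (a - p) + (b - p)).
elim: m p a b => // m IH p a b lt_m hpa hpb.
(* A letter that goes past tower [p] cannot share its cell with one that stops there. *)
have gt_p q : p < q -> slide_from T p.+1 q = Some c -> p < c.1.
  by move=> lt_pq /slide_from_bounds[]; rewrite ?lt_pq.
have col_p j : c = (p, j) -> p < c.1 -> False by move=> ->; rewrite ltnn.
rewrite (slide_from_step T hpa) (@slide_from_step T p b); last lia.
have := @nth_gt0_size T p.-1; move: (nth 0 T p.-1) => k gt0_size.
have [eka|nka] := eqVneq k (a - p).
  have [ekb _ _|nkb] := eqVneq k (b - p); first lia.
  case=> /esym ec; case: eqP => // nkb1; case: ltnP => hkb /gt_p h.
    by case: (col_p _ ec); apply: h; lia.
  by case: (col_p _ ec); apply: h; lia.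
have [//|nka1] := eqVneq k (a - p).+1.
have [ekb|nkb] := eqVneq k (b - p).
  case: ltnP => hka /gt_p h [/esym ec].
    by case: (col_p _ ec); apply: h; lia.
  by case: (col_p _ ec); apply: h; lia.
have [//|nkb1] := eqVneq k (b - p).+1.
case: ltnP => [hka|hka]; case: ltnP => hkb ea eb.
- have lt_pT : p.-1 < size T by apply: gt0_size; lia.
  suff : a.+1 = b.+1 by lia.
  by apply: IH ea eb; lia.
- have lt_pT : p.-1 < size T by apply: gt0_size; lia.
  suff : a.+1 = b by lia.
  by apply: IH ea eb; lia.
- have lt_pT : p.-1 < size T by apply: gt0_size; lia.
  suff : a = b.+1 by lia.
  by apply: IH ea eb; lia.
by apply: IH ea eb; lia.
Qed.

Lemma sliding_letterE T a c : 0 < a -> slide T a = Some c -> sliding_letter T c = a.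
Proof.
move=> a_gt0 slide_ac; have [//|_ le_a] := slide_from_bounds _ slide_ac.
have mem_a : a \in iota 1 (c.1 + c.2) by rewrite mem_iota; lia.
have has_c : has (fun b => slide T b == Some c) (iota 1 (c.1 + c.2)).
  by apply/hasP; exists a; rewrite ?slide_ac.
have := nth_find 0 has_c; move: (has_c); rewrite has_find size_iota => lt_find.
rewrite nth_iota // add1n => /eqP slide_fc.
exact: slide_from_inj slide_fc slide_ac.
Qed.

(** * Column sizes of the Rothe diagram and the effect of one letter *)

(* Indexed from 0, like the values of u: tower p + 1 has size tower_code u p. *)
Definition tower_code n (u : 'S_n) (p : nat) : nat :=
  #|[set q in inversions u | u q.2 == p :> nat]|.

Lemma tower_codeE n (u : 'S_n) (z : 'I_n) :
  tower_code u (u z) = #|[set y : 'I_n | (y < z) && (u z < u y)]|.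
Proof.
rewrite -(card_imset _ (_ : injective (fun y : 'I_n => (y, z)))) => [|y y' []//].
apply: eq_card => -[y z']; rewrite !inE /= val_eqE (inj_eq perm_inj).
apply/andP/imsetP => [[h /eqP ez]|[y' h [-> ->]]].
  by exists y; rewrite ?inE -?ez.
by move: h; rewrite inE.
Qed.

Lemma tower_code_ge n (u : 'S_n) p : n <= p -> tower_code u p = 0.
Proof.
move=> le_np; apply/eqP; rewrite cards_eq0; apply/eqP/setP => q.
by rewrite !inE ltn_eqF ?andbF // (leq_trans (ltn_ord _)).
Qed.

Lemma card_inversions n (u : 'S_n) :
  #|inversions u| = \sum_(p < n) tower_code u p.
Proof.
rewrite -sum1_card (partition_big (fun q => u q.2) predT) //=.
by apply: eq_bigr => p _; rewrite /tower_code -sum1_card; apply: eq_bigl => q; rewrite !inE.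
Qed.

Lemma val_tperm n (x y i : 'I_n) :
  tperm x y i = (if i == x :> nat then y else if i == y :> nat then x else i) :> nat.
Proof. by rewrite permE /= !val_eqE; do 2 case: ifP => //. Qed.

Lemma tperm_adj_lt n (x y i j : 'I_n) : y = x.+1 :> nat -> i < j ->
  ~~ ((i == x) && (j == y)) -> tperm x y i < tperm x y j.
Proof.
move=> exy lt_ij; rewrite -2!val_eqE !val_tperm /= => /andP nij.
by repeat case: eqP => //=; lia.
Qed.

(** The swap keeps the relative order of every other pair of entries, and the one new inversion has
    [u x] as its smaller value. *)
Lemma tower_code_adj n (u : 'S_n) (x y : 'I_n) p :
  y = x.+1 :> nat -> u x < u y ->
  tower_code (tperm x y * u)%g p = tower_code u p + (p == u x).
Proof.
move=> exy lt_u.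
have [le_np|lt_pn] := leqP n p.
  by rewrite !tower_code_ge // gtn_eqF // (leq_trans (ltn_ord _)).
have [z ez] : exists z, p = u z by exists (u^-1%g (Ordinal lt_pn)); rewrite permKV.
have et v : (tperm x y * u)%g v = u (tperm x y v) by rewrite permM.
have etz : u z = (tperm x y * u)%g (tperm x y z) by rewrite et tpermK.
rewrite ez {1}etz !tower_codeE -etz.
rewrite -(card_preimset _ (@perm_inj _ (tperm x y))).
have adj_lt v : tperm x y v < tperm x y z = if z == x then (v < x) || (v == y)
    else if z == y then (v < x) else v < z.
  rewrite -!val_eqE /= !val_tperm.
  by repeat case: eqP => //=; lia.
rewrite val_eqE (inj_eq perm_inj).
have [ezx|nzx] := eqVneq z x.
  rewrite ezx eqxx in adj_lt *.
  rewrite (cardsD1 y) !inE adj_lt et tpermK eqxx orbT lt_u addnC /=; congr addn.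
  apply: eq_card => v; rewrite !inE adj_lt et tpermK.
  by rewrite -val_eqE /=; case: (ltnP v x) => //=; lia.
rewrite addn0; apply: eq_card => v; rewrite !inE adj_lt et tpermK (negPf nzx).
have [ezy|//] := eqVneq z y; rewrite ezy exy ltnS [in RHS]leq_eqVlt.
have [/val_inj ->|//] := eqVneq (v : nat) x.
by rewrite ltnn [u y < u x]ltnNge ltnW.
Qed.

(** Termination never occurs: before reaching [u x], tower [p.+1] has either fewer than [d p] cells
    or at least [d p + 2]. *)
Lemma slide_tower_code n (u : 'S_n) (x y : 'I_n) T :
  (forall i, nth 0 T i = tower_code u i) -> y = x.+1 :> nat -> u x < u y ->
  slide T y = Some ((u x).+1, tower_code u (u x)).
Proof.
move=> nthT exy lt_u.
have codeE z : tower_code u (u z) = #|[set v : 'I_n | (v < z) && (u z <= u v)]|.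
  rewrite tower_codeE; apply: eq_card => v; rewrite !inE (leq_eqVlt (u z)) val_eqE.
  by rewrite (inj_eq perm_inj); case: eqVneq => [<-|//]; rewrite ltnn.
(* The letter reaching tower p + 1 is p + 1 + d p. *)
pose d p := #|[set v : 'I_n | (v < x) && (p <= u v)]|.
suff slide_d p : p <= u x ->
    slide_from T p.+1 (p.+1 + d p) = Some ((u x).+1, tower_code u (u x)).
  (* Every position below [x] counts in [d 0], so the initial letter is [x.+1], that is [y]. *)
  rewrite exy -(slide_d 0) // add1n; congr (slide_from _ _ _.+1); rewrite /d -sum1_card.
  rewrite (eq_bigl (fun v : 'I_n => v < x)) => [|v]; last by rewrite inE andbT.
  by rewrite -(big_ord_widen n (fun=> 1)) ?sum1_card ?card_ord // ltnW.
have [m] := ubnP (u x - p); elim: m p => // m IH p lt_m le_p.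
rewrite slide_from_step ?leq_addr //= addKn nthT.
have [ep|np] := eqVneq p (u x); first by rewrite {1 2}ep codeE /d ep eqxx.
have lt_pu : p < u x by rewrite ltn_neqAle np.
have lt_pn := ltn_trans lt_pu (ltn_ord _).
have [z ez] : exists z, p = u z by exists (u^-1%g (Ordinal lt_pn)); rewrite permKV.
have : z != x by apply: contraTneq lt_pu => <-; rewrite ez ltnn.
rewrite -val_eqE neq_ltn /= => /orP[lt_zx|lt_xz].
  (* The value [p] is left of [x]: discarding it lowers [d] by one, which offsets the move to the
     next tower, so the letter stays the same. *)
  have dE : d p = (d p.+1).+1.
    rewrite /d (cardsD1 z) inE lt_zx ez leqnn add1n; congr _.+1.
    apply: eq_card => v; rewrite !inE (ltn_neqAle (u z)) val_eqE (inj_eq perm_inj).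
    by rewrite andbCA eq_sym.
  have lt_cd : tower_code u p < d p.
    rewrite ez tower_codeE -ez dE ltnS; apply/subset_leq_card/subsetP => v.
    by rewrite !inE => /andP[/ltn_trans->].
  rewrite (ltn_eqF lt_cd) (ltn_eqF (leqW lt_cd)) ltnNge (ltnW lt_cd) /=.
  by rewrite dE addnS -addSn IH //; lia.
have lt_yz : y < z.
  rewrite exy ltn_neqAle lt_xz -exy val_eqE andbT.
  by apply: contraTneq lt_u => ->; rewrite -ez; lia.
have dE : d p = d p.+1.
  apply: eq_card => v; rewrite !inE (ltn_neqAle p) ez val_eqE (inj_eq perm_inj).
  by case: eqVneq => // <-; rewrite ltnNge ltnW.
(* Besides the entries counted by [d p], those at [x] and [y] also exceed [p] and precede it. *)
have lt_dc : (d p).+1 < tower_code u p.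
  have neq_yx : y != x by rewrite -val_eqE /= exy gtn_eqF.
  have le_px := ltnW lt_pu; have le_py := leq_trans le_px (ltnW lt_u).
  rewrite ez codeE -ez (cardsD1 x) (cardsD1 y) !inE lt_xz lt_yz neq_yx le_px le_py /=.
  rewrite !add1n !ltnS; apply/subset_leq_card/subsetP => v; rewrite !inE -!val_eqE /=.
  by lia.
rewrite gtn_eqF ?gtn_eqF //; last exact: ltnW.
rewrite (ltnW lt_dc).
by rewrite dE -addSn IH //; lia.
Qed.

(** * Words, their permutations and inversion counts *)

Lemma adjtranspE n (x y : 'I_n) : y = x.+1 :> nat -> adjtransp n y = tperm x y.
Proof. by move=> exy; rewrite /adjtransp {1}exy /= !valK. Qed.

(** Since positions in ['I_n] start at 0, a letter equals the upper of the two positions that it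
    swaps. *)
Lemma letter_ord n a : 0 < a < n -> exists x y : 'I_n, y = x.+1 :> nat /\ a = y.
Proof.
case: a => // a lt_an; exists (Ordinal (ltnW lt_an : a < n)), (Ordinal (lt_an : a.+1 < n)).
by [].
Qed.

Lemma adjtranspV n a : (adjtransp n a)^-1%g = adjtransp n a.
Proof.
rewrite /adjtransp; case: (@insub _ _ 'I_n _) => [i|]; last by rewrite invg1.
by case: (@insub _ _ 'I_n _) => [j|]; rewrite ?tpermV ?invg1.
Qed.

Lemma word_perm_rcons n s a :
  word_perm n (rcons s a) = (adjtransp n a * word_perm n s)%g.
Proof. by rewrite /word_perm foldl_rcons. Qed.

Lemma word_perm_cat n s t : word_perm n (s ++ t) = (word_perm n t * word_perm n s)%g.
Proof.
elim/last_ind: t => [|t a IH]; first by rewrite cats0 mul1g.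
by rewrite -rcons_cat !word_perm_rcons IH mulgA.
Qed.

Lemma word_perm_rev n s : word_perm n (rev s) = (word_perm n s)^-1%g.
Proof.
elim: s => [|a s IH]; first by rewrite invg1.
by rewrite rev_cons word_perm_rcons IH -cat1s word_perm_cat invMg /word_perm /= mulg1 adjtranspV.
Qed.

Lemma word_perm_take n s i (x y : 'I_n) : i < size s -> nth 0 s i = y ->
    y = x.+1 :> nat ->
  word_perm n (take i.+1 s) = (tperm x y * word_perm n (take i s))%g.
Proof. by move=> lt_i ey exy; rewrite (take_nth 0) // word_perm_rcons ey (adjtranspE exy). Qed.

Lemma inversions_adj n (u : 'S_n) (x y : 'I_n) : y = x.+1 :> nat -> u x < u y ->
  #|inversions (tperm x y * u)%g| = #|inversions u|.+1.
Proof.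
move=> exy lt_u; rewrite !card_inversions.
under eq_bigr => p _ do rewrite (tower_code_adj _ exy lt_u).
rewrite big_split /= -addn1; congr addn.
rewrite (bigD1 (u x)) //= eqxx big1 ?addn0 // => p; rewrite -val_eqE /=.
by case: eqP.
Qed.

Lemma inversions_adj_gt n (u : 'S_n) (x y : 'I_n) : y = x.+1 :> nat -> u y < u x ->
  #|inversions u| = #|inversions (tperm x y * u)%g|.+1.
Proof.
move=> exy lt_u; rewrite -(@inversions_adj _ (tperm x y * u)%g x y) //.
  by rewrite mulgA tperm2 mul1g.
by rewrite !permM tpermL tpermR.
Qed.

Lemma inversions_word_le n s t : all (fun a => 0 < a < n) t ->
  #|inversions (word_perm n (s ++ t))| <= #|inversions (word_perm n s)| + size t.
Proof.
elim/last_ind: t => [|t a IH]; first by rewrite cats0 addn0.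
rewrite all_rcons => /andP[/letter_ord[x [y [exy ->]]] /IH le_t].
rewrite -rcons_cat word_perm_rcons (adjtranspE exy) size_rcons addnS.
set v := word_perm n (s ++ t) in le_t *.
have : v x != v y by rewrite (inj_eq perm_inj) -val_eqE /= exy ltn_eqF.
rewrite -val_eqE neq_ltn => /orP[/(inversions_adj exy) ->//|/(inversions_adj_gt exy)].
by move: le_t; set k := #|inversions (_ * _)%g|; lia.
Qed.

(** Each letter adds at most one inversion, so a step that removes one would leave the total below
    [size s]. *)
Lemma reduced_ascent n (w : 'S_n) s i (x y : 'I_n) : reduced_word w s ->
    i < size s -> nth 0 s i = y -> y = x.+1 :> nat ->
  word_perm n (take i s) x < word_perm n (take i s) y.
Proof.
move=> /and3P[valid_s /eqP ew /eqP size_s] lt_i ey exy.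
move: valid_s; rewrite -{1}(cat_take_drop i.+1 s) all_cat => /andP[valid1 valid2].
have := inversions_word_le (take i.+1 s) valid2; rewrite cat_take_drop ew -size_s.
have := valid1; rewrite (take_nth 0) // all_rcons => /andP[_ /(inversions_word_le [::])].
rewrite /= size_take lt_i -(take_nth 0) // (word_perm_take lt_i ey exy) size_drop.
have -> : #|inversions (word_perm n [::])| = 0.
  apply/eqP; rewrite cards_eq0; apply/eqP/setP => p; rewrite !inE !perm1.
  by case: ltngtP.
set v := word_perm n (take i s) => le1 le2.
have : v x != v y by rewrite (inj_eq perm_inj) -val_eqE /= exy ltn_eqF.
rewrite -val_eqE neq_ltn => /orP[//|/(inversions_adj_gt exy)].
by move=> ev; move: le1 le2; rewrite ev; set k := #|inversions (_ * _)%g|; lia.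
Qed.

Lemma inversionsV n (u : 'S_n) : #|inversions u^-1%g| = #|inversions u|.
Proof.
suff le v : #|inversions v| <= #|inversions (v^-1)%g :> {set 'I_n * 'I_n}|.
  by apply/eqP; rewrite eqn_leq (le u) andbT; have := le u^-1%g; rewrite invgK.
rewrite -(card_imset (mem (inversions v)) (_ : injective (fun p : 'I_n * 'I_n => (v p.2, v p.1)))).
  apply/subset_leq_card/subsetP => _ /imsetP[p + ->].
  by rewrite !inE /= !permK andbC.
by move=> [a b] [c d] [/perm_inj -> /perm_inj ->].
Qed.

Lemma reduced_word_rev n (w : 'S_n) s : reduced_word w s -> reduced_word w^-1%g (rev s).
Proof.
case/and3P => valid_s /eqP ew size_s.
by rewrite /reduced_word all_rev valid_s word_perm_rev ew eqxx size_rev inversionsV.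
Qed.

(** * The standard tower tableau of a reduced word *)

Lemma slide_word_rcons T s U a c : slide_word T s = Some U ->
    slide (foldl add_cell T U) a = Some c ->
  slide_word T (rcons s a) = Some (rcons U c).
Proof.
elim: s T U => [|b s IH] T U /=; first by move=> [<-] /= ->.
case: (slide T b) => //= d; case E: slide_word => [V|] //= [<-] /= h.
by rewrite (IH _ _ E h).
Qed.

Lemma nth_add_cell T c i : nth 0 (add_cell T c) i = nth 0 T i + (i == c.1.-1).
Proof. by rewrite nth_incr_nth addnC eq_sym. Qed.

(** The last clause serves twice: for the word it gives the columns of the Rothification, for the
    reversed word its rows. *)
Lemma standard_tableau_reduced n (w : 'S_n) s : reduced_word w s ->
  exists U, [/\ standard_tableau s = Some U, size U = size s, reading_word U = s
    & forall i (x y : 'I_n), i < size s -> nth 0 s i = y -> y = x.+1 :> nat ->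
        (nth (0, 0) U i).1 = (word_perm n (take i s) x).+1].
Proof.
move=> red_s; have /and3P[/allP valid_s _ _] := red_s.
suff [U [tabU sizeU _ rowU slideU]] : exists U,
    [/\ standard_tableau (take (size s) s) = Some U, size U = size s,
       forall i, nth 0 (Defs.shape U) i = tower_code (word_perm n (take (size s) s)) i,
       forall i (x y : 'I_n), i < size s -> nth 0 s i = y -> y = x.+1 :> nat ->
         (nth (0, 0) U i).1 = (word_perm n (take i s) x).+1
     & forall i, i < size s ->
         slide (Defs.shape (take i U)) (nth 0 s i) = Some (nth (0, 0) U i)].
  rewrite take_size in tabU; exists U; split=> //.
  apply: (@eq_from_nth _ 0); rewrite size_map size_iota // => i lt_i.
  rewrite (nth_map 0) ?size_iota // nth_iota //= /cell_labelled add1n /=.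
  rewrite sizeU in lt_i.
  apply: sliding_letterE; last exact: slideU.
  by have /andP[] := valid_s _ (mem_nth 0 lt_i).
(* Induction on the length [k] of a prefix; only the upper bound in [k <= size s] stays fixed. *)
elim: {1 3 4 5 6 7}(size s) (leqnn (size s)) => [_|k IH lt_k].
  exists [::]; rewrite take0; split=> // i; rewrite nth_nil; apply/esym/eqP.
  rewrite cards_eq0; apply/eqP/setP => p; rewrite !inE !perm1.
  by case: ltngtP.
have [U [tabU sizeU shapeU rowU slideU]] := IH (ltnW lt_k).
have [x [y [exy ey]]] := letter_ord (valid_s _ (mem_nth 0 lt_k)).
have asc := reduced_ascent red_s lt_k ey exy.
have slide_y := slide_tower_code shapeU exy asc.
move: slide_y; set c := (_, _) => slide_y.
exists (rcons U c); split.
- rewrite (take_nth 0 lt_k); apply: slide_word_rcons tabU _.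
  by rewrite ey; apply: slide_y.
- by rewrite size_rcons sizeU.
- move=> i; rewrite /Defs.shape foldl_rcons nth_add_cell shapeU.
  by rewrite (word_perm_take lt_k ey exy) (tower_code_adj _ exy asc).
- move=> i x' y'; rewrite ltnS leq_eqVlt nth_rcons sizeU.
  case/predU1P => [->|lt_i]; last by rewrite lt_i; apply: rowU.
  rewrite ltnn eqxx ey => /val_inj <-.
  by rewrite exy => -[/val_inj <-].
move=> i; rewrite ltnS leq_eqVlt nth_rcons sizeU.
case/predU1P => [->|lt_i].
  by rewrite ltnn eqxx ey -cats1 -{1}sizeU take_size_cat.
by rewrite lt_i -cats1 takel_cat ?sizeU ?slideU // 1?ltnW.
Qed.

(** * Each pair of values is swapped at most once *)

(** Only a swap of the two values themselves could restore their order, but each step of a reduced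
    word swaps an ascent. *)
Lemma inverted_persists n (w : 'S_n) s i k (b c : 'I_n) : reduced_word w s ->
    c < b -> i <= k <= size s ->
  (word_perm n (take i s))^-1%g b < (word_perm n (take i s))^-1%g c ->
  (word_perm n (take k s))^-1%g b < (word_perm n (take k s))^-1%g c.
Proof.
move=> red_s lt_cb /andP[le_ik le_k] lt_i.
elim: k le_ik le_k => [|k IH]; first by rewrite leqn0 => /eqP <-.
rewrite leq_eqVlt => /predU1P[<- //|le_ik] lt_k; have {IH} := IH le_ik (ltnW lt_k).
have /and3P[/allP valid_s _ _] := red_s.
have [x [y [exy ey]]] := letter_ord (valid_s _ (mem_nth 0 lt_k)).
have asc := reduced_ascent red_s lt_k ey exy.
rewrite (word_perm_take lt_k ey exy) invMg tpermV !permM => lt_bc.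
apply: tperm_adj_lt => //; apply/andP => -[/eqP ebx /eqP ecy].
by move: asc; rewrite -ebx -ecy !permKV ltnNge ltnW.
Qed.

Lemma swap_stepE n (w : 'S_n) s i (x y : 'I_n) : reduced_word w s ->
    i < size s -> nth 0 s i = y -> y = x.+1 :> nat ->
  swap_step s (word_perm n (take i s) y) (word_perm n (take i s) x) = i.+1.
Proof.
move=> red_s lt_i ey exy; have asc := reduced_ascent red_s lt_i ey exy.
rewrite /swap_step; set b := word_perm _ _ y; set c := word_perm _ _ x.
have swap_i : swaps_at s b c i.+1.
  by rewrite /swaps_at (word_perm_take lt_i ey exy) /= conjgC tpermJ tpermC.
have swap_lt j : j < i -> ~~ swaps_at s b c j.+1.
  move=> lt_ji; apply/negP => /eqP /= eq_j.
  have not_inv k : k <= i ->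
      ((word_perm n (take k s))^-1%g b < (word_perm n (take k s))^-1%g c) = false.
    move=> le_ki; apply/negP => /(@inverted_persists _ _ _ _ i _ _ red_s asc).
    by rewrite le_ki ltnW // !permK exy ltnNge leqnSn => /(_ isT).
  (* An earlier swap at step [j.+1] would put [b] and [c] in opposite orders before and after it,
     hence inverted at one of these two times, both no later than [i]. *)
  have := not_inv _ lt_ji; have := not_inv _ (ltnW lt_ji).
  rewrite eq_j invMg tpermV !permM tpermL tpermR.
  case: ltngtP => // /val_inj /perm_inj ebc _ _.
  by move: asc; rewrite -/b -/c ebc ltnn.
congr _.+1; set a := swaps_at s b c in swap_i swap_lt *.
have nth_step j : j < size s -> nth 0 (iota 1 (size s)) j = j.+1 by move=> ?; rewrite nth_iota.
have has_a : has a (iota 1 (size s)).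
  by apply/hasP; exists i.+1; rewrite // mem_iota add1n ltnS.
have lt_find : find a (iota 1 (size s)) < size s by rewrite -{2}(size_iota 1 (size s)) -has_find.
have [lt_fi|lt_if|//] := ltngtP (find a (iota 1 (size s))) i.
  by have := nth_find 0 has_a; rewrite nth_step // (negPf (swap_lt _ lt_fi)).
by have := before_find 0 lt_if; rewrite nth_step // swap_i.
Qed.

(** * Comparison of the two labelled diagrams *)

Lemma card_imfset_set (T : finType) (K : choiceType) (f : T -> K) (A : {set T}) :
  #|` [fset f x | x in A]%fset| <= #|A|.
Proof.
apply: leq_trans (leq_imfset_card _ _ _) _.
have /card_uniqP <- := enum_finmem_uniq (mem A).
by apply/eq_leq/eq_card => x; rewrite enum_finmemE.
Qed.

Theorem mainTheorem5 (n : nat) (w : 'S_n) (alpha : seq nat) :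
  reduced_word w alpha ->
  exists T : tower_tableau,
    standard_tableau alpha = Some T /\
    rothification T = Some (canonical_labelling w alpha).
Proof.
move=> red_w; have red_wV := reduced_word_rev red_w.
have [T [tabT sizeT readT colT]] := standard_tableau_reduced red_w.
have [T' [tabT' sizeT' _ rowT']] := standard_tableau_reduced red_wV.
exists T; split=> //; rewrite /rothification readT tabT' /= sizeT; congr Some.
have /and3P[/allP valid_w /eqP ew /eqP size_w] := red_w.
(* Inclusion together with a cardinality bound gives equality. *)
apply/eqP; rewrite eqEfcard; apply/andP; split.
  apply/fsubsetP => _ /imfsetP[r /= + ->]; rewrite mem_iota add1n ltnS.
  case: r => // i /= lt_i.
  have [x [y [exy ey]]] := letter_ord (valid_w _ (mem_nth 0 lt_i)).
  (* The 0-based index, in the reversed word, of the letter with label [i.+1]. *)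
  set j := size alpha - i.+1.
  have lt_j : j < size (rev alpha) by rewrite size_rev /j; lia.
  have ej : size alpha - j.+1 = i by rewrite /j; lia.
  have ey' : nth 0 (rev alpha) j = y by rewrite nth_rev -?(size_rev alpha) // size_rev ej.
  rewrite /cell_labelled /= subSS -subnS -/j (rowT' _ _ _ lt_j ey' exy) (colT _ _ _ lt_i ey exy).
  have := reduced_ascent red_wV lt_j ey' exy; have := reduced_ascent red_w lt_i ey exy.
  rewrite -(swap_stepE red_w lt_i ey exy).
  set u := word_perm n (take i alpha); set v := word_perm n (take j _) => asc_u asc_v.
  (* [v] is the inverse of the permutation of the letters after index [i], so these cancel in
     [w]. *)
  have w_v z : w (v z) = u (tperm x y z).
    rewrite -!permM -(word_perm_take lt_i ey exy) -{1}ew -{1}(cat_take_drop i.+1 alpha).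
    by rewrite word_perm_cat /v take_rev subKn // word_perm_rev mulKg.
  apply/imfsetP; exists (v x, u x) => /=; last by rewrite w_v tpermL.
  apply/imsetP; exists (v x, v y); last by rewrite /= w_v tpermR.
  by rewrite inE /= !w_v tpermL tpermR asc_v.
(* The labels alone are distinct, so the Rothification has [size alpha] elements, one per inversion
   of [w]. *)
rewrite [leqRHS]card_in_imfset /= => [|r r' _ _ [] //].
rewrite undup_id ?iota_uniq // size_iota size_w; apply: leq_trans (leq_imset_card (fun p => (p.1, w p.2)) _).
exact: card_imfset_set.
Qed.
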